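(* Let $\mathcal{C}$ be an equational class of algebras, $(A_i)_{i\in I}$ a non-empty family of algebras from $\mathcal{C}$ and $A=\prod_{i\in I}A_i$, and assume that $\mathrm{Con}(A)=\{\prod_{i\in I}\theta_i : \theta_i\in \mathrm{Con}(A_i)\text{ for all }i\in I\}$. Then: (1) $\mathrm{Con}_2(A)=\bigcup_{i\in I}\{\theta_i\times\prod_{j\in I\setminus\{i\}}\nabla_{A_j} : \theta_i\in \mathrm{Con}_2(A_i)\}$; (2) $\mathrm{Max}(A)=\bigcup_{i\in I}\{\theta_i\times\prod_{j\in I\setminus\{i\}}\nabla_{A_j} : \theta_i\in \mathrm{Max}(A_i)\}$; moreover, $\mathrm{Max}(A)=\mathrm{Con}_2(A)$ iff $\mathrm{Max}(A_i)=\mathrm{Con}_2(A_i)$ for all $i\in I$; (3) if $\mathcal{C}$ is congruence-modular and, for any families $(\alpha_i)_{i\in I}$ and $(\beta_i)_{i\in I}$ such that $\alpha_i,\beta_i\in \mathrm{Con}(A_i)$ for all $i\in I$, we have $[\prod_{i\in I}\alpha_i,\prod_{i\in I}\beta_i]_A=\prod_{i\in I}[\alpha_i,\beta_i]_{A_i}$, then: $\mathrm{Spec}(A)=\bigcup_{i\in I}\{\theta_i\times\prod_{j\in I\setminus\{i\}}\nabla_{A_j} : \theta_i\in \mathrm{Spec}(A_i)\}$; $\mathrm{Spec}(A)=\mathrm{Con}_2(A)$ iff $\mathrm{Spec}(A_i)=\mathrm{Con}_2(A_i)$ for all $i\in I$; and $\mathrm{Spec}(A)=\mathrm{Max}(A)$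 iff $\mathrm{Spec}(A_i)=\mathrm{Max}(A_i)$ for all $i\in I$.
   Context: All algebras are non-empty. $\mathrm{Con}(M)$ is the lattice of congruences of $M$ ordered by inclusion, with greatest element $\nabla_M=M^2$. $\mathrm{Con}_2(M)=\{\theta\in \mathrm{Con}(M) : |M/\theta|=2\}$. $\mathrm{Max}(M)$ is the set of maximal elements of $\mathrm{Con}(M)\setminus\{\nabla_M\}$. The direct product of binary relations is $\prod_{i} R_i=\{((a_i)_i,(b_i)_i) : (a_i,b_i)\in R_i\text{ for all }i\}$; in $\theta_i\times\prod_{j\neq i}\nabla_{A_j}$ the factor $\theta_i$ is in the $i$-th coordinate. An equational class (variety) is congruence-modular if $\mathrm{Con}(M)$ is modular for each member $M$. In a congruence-modular equational class, $[\alpha,\beta]_M$ denotes the (Freese–McKenzie) commutator of $\alpha,\beta\in \mathrm{Con}(M)$: the least $\delta\in \mathrm{Con}(M)$ such that for all $m,n$, every $(m+n)$-ary term $t$, all $(a_i,b_i)\in\alpha$ ($1\le i\le m$) and all $(c_j,d_j)\in\beta$ ($1\le j\le n$), $(t(\bar a,\bar c),t(\bar a,\bar d))\in\delta$ implies $(t(\bar b,\bar c),t(\bar b,\bar d))\in\delta$. A congruence $\phi\neq\nabla_M$ is prime if, for all $\alpha,\beta\in \mathrm{Con}(M)$, $[\alpha,\beta]_M\subseteq\phi$ implies $\alpha\subseteq\phi$ or $\beta\subseteq\phi$; $\mathrm{Spec}(M)$ is the set of prime congruences of $M$. *)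

(* Defs.v *)
From mathcomp Require Import all_boot.
From mathcomp Require Import boolp classical_sets cardinality.

Set Implicit Arguments.
Unset Strict Implicit.
Unset Printing Implicit Defensive.

Local Open Scope classical_set_scope.
Local Open Scope card_scope.

(** Binary relations on [M] are sets of pairs, [set (M * M)]; by the classical
    axioms of [boolp], extensionally equal relations are equal. *)

Record signature := Signature { symbol : Type; arity : symbol -> nat }.

Record algebra (S : signature) := Algebra {
  carrier :> Type;
  op : forall f : symbol S, ('I_(arity f) -> carrier) -> carrier;
  carrier_inhabited : inhabited carrier }.

Section Terms.
Variable S : signature.

Inductive term (V : Type) : Type :=
| Var of V
| App (f : symbol S) of ('I_(arity f) -> term V).

Fixpoint eval (M : algebra S) (V : Type) (v : V -> M) (t : term V) : M :=
  match t with
  | Var x => v x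
  | App f ts => op (fun k => eval v (ts k))
  end.

(* Terms are finitary, so countably many variables suffice for equations. *)
Definition satisfies (M : algebra S) (e : term nat * term nat) : Prop :=
  forall v : nat -> M, eval v e.1 = eval v e.2.

Definition equational_class (C : set (algebra S)) : Prop :=
  exists E : set (term nat * term nat),
    C = [set M | forall e, E e -> satisfies M e].

End Terms.

Section Congruences.
Variables (S : signature) (M : algebra S).

Definition Con : set (set (M * M)) :=
  [set th | [/\ forall x, th (x, x),
                forall x y, th (x, y) -> th (y, x),
                forall x y z, th (x, y) -> th (y, z) -> th (x, z) &
                forall (f : symbol S) (a b : 'I_(arity f) -> M),
                  (forall k, th (a k, b k)) -> th (op a, op b)]].

Definition nabla : set (M * M) := setT.

Definition quotient (th : set (M * M)) : set (set M) :=
  [set [set y | th (x, y)] | x in setT].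

Definition Con2 : set (set (M * M)) :=
  [set th | Con th /\ quotient th #= `I_2].

Definition Max : set (set (M * M)) :=
  [set th | (Con `\ nabla) th /\
            forall ph, (Con `\ nabla) ph -> th `<=` ph -> ph = th].

Definition joinCon (al be : set (M * M)) : set (M * M) :=
  smallest Con (al `|` be).

Definition modularCon : Prop :=
  forall al be ga, Con al -> Con be -> Con ga -> al `<=` ga ->
    joinCon al (be `&` ga) = joinCon al be `&` ga.

Definition catf m n (a : 'I_m -> M) (c : 'I_n -> M) (k : 'I_(m + n)) : M :=
  match split k with inl i => a i | inr j => c j end.

Definition term_condition (al be de : set (M * M)) : Prop :=
  forall (m n : nat) (t : term S 'I_(m + n))
         (a b : 'I_m -> M) (c d : 'I_n -> M),
    (forall i, al (a i, b i)) -> (forall j, be (c j, d j)) ->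
    de (eval (catf a c) t, eval (catf a d) t) ->
    de (eval (catf b c) t, eval (catf b d) t).

(* An intersection; [commutator_least] shows it is attained. *)
Definition commutator (al be : set (M * M)) : set (M * M) :=
  \bigcap_(de in [set de | Con de /\ term_condition al be de]) de.

Definition Spec : set (set (M * M)) :=
  [set ph | [/\ Con ph, ph <> nabla &
     forall al be, Con al -> Con be -> commutator al be `<=` ph ->
       al `<=` ph \/ be `<=` ph]].

Lemma Con_nabla : Con nabla. Proof. by []. Qed.

Lemma Con_bigcap (F : set (set (M * M))) :
  F `<=` Con -> Con (\bigcap_(th in F) th).
Proof.
move=> FC; split=> [x th /FC[+ _ _ _]|x y xy th Fth|x y z xy yz th Fth|
                    f a b ab th Fth]; first exact.
- by have [_ s _ _] := FC _ Fth; exact: s (xy _ Fth).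
- by have [_ _ t _] := FC _ Fth; exact: t (xy _ Fth) (yz _ Fth).
- by have [_ _ _ o] := FC _ Fth; apply: o => k; exact: ab.
Qed.

Lemma joinCon_least (al be : set (M * M)) :
  [/\ Con (joinCon al be), al `|` be `<=` joinCon al be &
      forall de, Con de -> al `|` be `<=` de -> joinCon al be `<=` de].
Proof.
split=> [|x abx de [_]|de Cde abd x]; last 1 first.
- exact.
- by apply: Con_bigcap => de [].
- exact.
Qed.

Lemma commutator_least (al be : set (M * M)) :
  [/\ Con (commutator al be), term_condition al be (commutator al be) &
      forall de, Con de -> term_condition al be de ->
        commutator al be `<=` de].
Proof.
split=> [|m n t a b c d ab cd tt de [Cde Tde]|de Cde Tde x]; last 1 first.
- exact.
- by apply: Con_bigcap => de [].
- by apply: (Tde m n t a b c d ab cd); exact: (tt de (conj Cde Tde)).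
Qed.

End Congruences.

Arguments Con {S} M.
Arguments nabla {S} M.
Arguments Con2 {S} M.
Arguments Max {S} M.
Arguments modularCon {S} M.
Arguments Spec {S} M.

Definition congruence_modular (S : signature) (C : set (algebra S)) : Prop :=
  forall M, C M -> modularCon M.

Section Products.
Variables (S : signature) (I : Type) (A : I -> algebra S).

Lemma prod_inhabited : inhabited (forall i, A i).
Proof.
have /(_ _)/cid cA : forall i, exists x : A i, True.
  by move=> i; have [x] := carrier_inhabited (A i); exists x.
by constructor=> i; exact: projT1 (cA i).
Qed.

Definition prod_algebra : algebra S :=
  @Algebra S (forall i, A i) (fun f a i => op (fun k => a k i)) prod_inhabited.

Definition prod_rel (R : forall i, set (A i * A i)) :
    set (prod_algebra * prod_algebra) :=
  [set ab | forall i, R i (ab.1 i, ab.2 i)].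

(* [th] in coordinate [i], the total relation in the others; [{classic I}]
   gives the arbitrary index type [I] the decidable equality of [dfwith]. *)
Definition prod_rel_at (i : I) (th : set (A i * A i)) :
    set (prod_algebra * prod_algebra) :=
  prod_rel (@eqtype.dfwith {classic I} (fun j => set (A j * A j))
              (fun j => nabla (A j)) i th).

End Products.

Arguments prod_rel {S I} A R.
Arguments prod_rel_at {S I} A i th.

(* Main.v *)
Require Import Defs.
From mathcomp Require Import all_boot.
From mathcomp Require Import boolp classical_sets cardinality.

Local Open Scope classical_set_scope.

(** The congruence [prod_rel_at A i th] is the preimage of [th] under the
    projection to [A i], so each of the three classes contains it iff the
    class on [A i] contains [th].  Conversely, let [ph] be the product of a
    family [th] and [th i <> nabla].  If [ph] is maximal, it equals
    [prod_rel_at A i (th i)], which is proper and contains it; two-class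
    congruences are maximal.  If [ph] is prime, it is the intersection of
    [prod_rel_at A i (th i)] with the congruence [be] that is [th j] in
    every coordinate [j <> i] and total in [i]; the commutator lies below the
    intersection and [be] is not contained in [ph], so again
    [ph = prod_rel_at A i (th i)]. *)

(** Two points are removed from [X] one after the other, leaving the empty set. *)
Lemma card_eq2P (T : Type) (X : set T) :
  card_eq X `I_2 <->
  exists x y, [/\ X x, X y, x <> y & forall z, X z -> z = x \/ z = y].
Proof.
split=> [/eq_cardSP[x Xx /eq_cardSP[y [Xy yx]]]|[x [y [Xx Xy xy Xxy]]]].
  rewrite II0 card_eq0 => /eqP X0; exists x, y; split=> // [xy|z Xz].
    by apply: yx; rewrite xy.
  apply: contrapT => /not_orP[zx zy].
  suff : set0 z by [].
  by rewrite -X0.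
apply/eq_cardSP; exists x => //; apply/eq_cardSP; exists y.
  by split=> // yx; apply: xy.
rewrite II0 card_eq0; apply/eqP/seteqP; split=> // z [[Xz zx] zy].
by case: (Xxy z Xz).
Qed.

(** * Two-class congruences and the commutator in one algebra *)

Section Algebra.
Context {S : signature} {M : algebra S}.
Implicit Types al be th ph : set (M * M).

(** The points [x] and [y] represent the two classes. In this form the property can be carried along
    the projections of a product. *)
Lemma Con2P th : Con M th ->
  Con2 M th <-> exists x y, ~ th (x, y) /\ forall z, th (x, z) \/ th (y, z).
Proof.
move=> Cth; have [r s t _] := Cth.
have clsE x y : [set z | th (x, z)] = [set z | th (y, z)] <-> th (x, y).
  split=> [e|xy].
    suff : [set z | th (x, z)] y by [].
    by rewrite e; exact: r.
  by apply/seteqP; split=> z /=; apply: t => //; apply: s.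
split=> [[_ /card_eq2P[X [Y [[x _ <-] [y _ <-] xy XY]]]]|[x [y [xy xyP]]]].
  exists x, y; split=> [/clsE//|z].
  have [|/clsE/s|/clsE/s] := XY [set w | th (z, w)]; by [exists z|left|right].
split=> //; apply/card_eq2P.
exists [set w | th (x, w)], [set w | th (y, w)].
split; [by exists x|by exists y|by move/clsE|].
by move=> _ [z _ <-]; case: (xyP z) => ?; [left|right]; apply/clsE/s.
Qed.

(** A pair lying in a larger congruence [ph] but not in [th] joins the two classes of [th], so [ph]
    is total. *)
Lemma sub_Con2_Max : Con2 M `<=` Max M.
Proof.
move=> th Kth; have Cth := proj1 Kth.
have [x [y [xy xyP]]] := proj1 (Con2P th Cth) Kth.
have [_ s t _] := Cth.
split=> [|ph [Cph phN] thph]; first by split=> // e; apply: xy; rewrite e.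
apply/seteqP; split=> // -[a b] ab; apply: contrapT => nab; apply: phN.
have [_ sp tp _] := Cph.
have pxy : ph (x, y).
  (* If [a] and [b] share a class, [nab] fails; otherwise [x] and [y] are linked through [a] and
     [b]. *)
  case: (xyP a) => ha; case: (xyP b) => hb.
  - by case: nab; exact: t (s _ _ ha) hb.
  - exact: tp (tp _ _ _ (thph _ ha) ab) (sp _ _ (thph _ hb)).
  - exact: sp (tp _ _ _ (tp _ _ _ (thph _ ha) ab) (sp _ _ (thph _ hb))).
  - by case: nab; exact: t (s _ _ ha) hb.
have px z : ph (x, z).
  by case: (xyP z) => /thph // yz; exact: tp pxy yz.
by apply/seteqP; split=> // -[c d] _; exact: tp (sp _ _ (px c)) (px d).
Qed.

(** Both [al] and [be] satisfy the term condition, and the commutator is the least such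
    congruence. *)
Lemma sub_commutator_setI al be :
  Con M al -> Con M be -> commutator al be `<=` al `&` be.
Proof.
move=> Cal Cbe; have [_ sa ta oa] := Cal; have [rb _ _ ob] := Cbe.
have eval_Con ga V (t : term S V) (u v : V -> M) : Con M ga ->
    (forall x, ga (u x, v x)) -> ga (eval u t, eval v t).
  move=> [_ _ _ o] uv; elim: t => [x|f ts IH] /=; first exact: uv.
  by apply: o => k; exact: IH.
have [_ _ least] := commutator_least al be.
move=> p cp; split; move: p cp; apply: least => // m n t a b c d ab cd tt.
  (* For [al], the chain is t(b,c), t(a,c), t(a,d), t(b,d). For [be], the arguments of t(b,c) and
     t(b,d) are already related one by one. *)
  have tabP e : al (eval (catf a e) t, eval (catf b e) t).
    apply: eval_Con => // k; rewrite /catf.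
    by case: split => j //; case: Cal.
  exact: ta (sa _ _ (tabP c)) (ta _ _ _ tt (tabP d)).
apply: eval_Con => // k; rewrite /catf.
by case: split => j.
Qed.

End Algebra.

(** * Congruences of a product that come from one coordinate *)

Section Product.
Context {S : signature} {I : Type} {A : I -> algebra S}.
Local Notation P := (prod_algebra A).
Implicit Types i j : I.

Lemma prod_rel_atE i (th : set (A i * A i)) :
  prod_rel_at A i th = [set uv | th (uv.1 i, uv.2 i)].
Proof.
apply/seteqP; split=> [[u v] /(_ i) /=|[u v] /= uv j /=].
  by rewrite (@dfwith_in {classic I}).
by case: (@dfwithP {classic I}).
Qed.

Lemma prod_lift i (x : A i) : exists u : P, u i = x.
Proof.
have [u] := carrier_inhabited P.
exists (@eqtype.dfwith {classic I} A u i x).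
by rewrite (@dfwith_in {classic I}).
Qed.

(** Such a pair tests a relation on the product in coordinate [i] alone, since reflexivity settles
    the other coordinates. *)
Lemma prod_lift2 i (x y : A i) :
  exists u v : P, [/\ u i = x, v i = y & forall j, j <> i -> u j = v j].
Proof.
have [w] := carrier_inhabited P.
exists (@eqtype.dfwith {classic I} A w i x).
exists (@eqtype.dfwith {classic I} A w i y).
split; rewrite ?(@dfwith_in {classic I})// => j ji.
by rewrite !(@dfwith_out {classic I})//; apply/eqP => /esym.
Qed.

Lemma sub_prod_rel_at i (th ph : set (A i * A i)) :
  prod_rel_at A i th `<=` prod_rel_at A i ph <-> th `<=` ph.
Proof.
rewrite !prod_rel_atE; split=> [h [x y]|h [u v]]; last exact: h.
have [u <-] := prod_lift i x; have [v <-] := prod_lift i y.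
exact: (h (u, v)).
Qed.

Lemma prod_rel_at_inj i : injective (prod_rel_at A i).
Proof.
by move=> th ph e; apply/seteqP; split; apply/sub_prod_rel_at; rewrite e.
Qed.

Lemma prod_rel_at_nabla i : prod_rel_at A i (nabla (A i)) = nabla P.
Proof. by rewrite prod_rel_atE; apply/seteqP; split. Qed.

Lemma prod_rel_at_eq_nabla i (th : set (A i * A i)) :
  prod_rel_at A i th = nabla P <-> th = nabla (A i).
Proof.
by rewrite -(prod_rel_at_nabla i); split=> [/prod_rel_at_inj|->].
Qed.

Lemma Con_prod_rel_at i (th : set (A i * A i)) :
  Con P (prod_rel_at A i th) <-> Con (A i) th.
Proof.
rewrite prod_rel_atE; split=> -[r s t o]; split.
- by move=> x; have [u <-] := prod_lift i x; exact: r u.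
- move=> x y; have [u <-] := prod_lift i x; have [v <-] := prod_lift i y.
  exact: s u v.
- move=> x y z; have [u <-] := prod_lift i x; have [v <-] := prod_lift i y.
  by have [w <-] := prod_lift i z; exact: t u v w.
- move=> f a b ab.
  (* Every argument of the operation is lifted to the product, where compatibility is known. *)
  have /choice[a' a'E] k : exists u : P, u i = a k by exact: prod_lift.
  have /choice[b' b'E] k : exists u : P, u i = b k by exact: prod_lift.
  have -> : a = a' ^~ i by apply/funext => k; rewrite a'E.
  have -> : b = b' ^~ i by apply/funext => k; rewrite b'E.
  by apply: (o f a' b') => k /=; rewrite a'E b'E.
- by move=> u; exact: r.
- by move=> u v; exact: s.
- by move=> u v w; exact: t.
- by move=> f a b ab; exact: o.
Qed.

Lemma Con2_prod_rel_at i (th : set (A i * A i)) :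
  Con2 P (prod_rel_at A i th) <-> Con2 (A i) th.
Proof.
(* Either side makes [th] a congruence, so this may be assumed. *)
suff E : Con (A i) th -> Con2 P (prod_rel_at A i th) <-> Con2 (A i) th.
  by split=> K; apply/E => //; case: K => // /Con_prod_rel_at.
move=> Cth; rewrite !Con2P//; last exact/Con_prod_rel_at.
rewrite prod_rel_atE; split=> [[u [v [uv uvP]]]|[x [y]]].
  exists (u i), (v i); split=> // z.
  by have [w <-] := prod_lift i z; exact: uvP w.
have [u <-] := prod_lift i x; have [v <-] := prod_lift i y.
by move=> [uv uvP]; exists u, v; split=> // w; exact: uvP.
Qed.

Lemma prod_rel_sub_at i (th : forall j, set (A j * A j)) :
  prod_rel A th `<=` prod_rel_at A i (th i).
Proof. by move=> [u v] uv; rewrite prod_rel_atE; exact: uv. Qed.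

Lemma prod_rel_neq_nabla (th : forall j, set (A j * A j)) :
  prod_rel A th <> nabla P -> exists i, th i <> nabla (A i).
Proof.
move=> thN; apply: contrapT => /forallNP N; apply: thN.
by apply/seteqP; split=> // -[u v] _ j; rewrite (contrapT (N j)).
Qed.

(** * Transfer for any classes tested in, and concentrated on, one coordinate; [K] and [L] range
    over [Con2], [Max] and [Spec] *)

Section Classes.
Variables K L : forall M : algebra S, set (set (M * M)).
Arguments K : clear implicits.
Arguments L : clear implicits.
Hypothesis K_at :
  forall i th, K P (prod_rel_at A i th) <-> K (A i) th.
Hypothesis L_at :
  forall i th, L P (prod_rel_at A i th) <-> L (A i) th.
Hypothesis K_conc :
  forall ph, K P ph -> exists i th, ph = prod_rel_at A i th.
Hypothesis L_conc :
  forall ph, L P ph -> exists i th, ph = prod_rel_at A i th.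

Lemma class_prod :
  K P = \bigcup_(i in [set: I]) [set prod_rel_at A i th | th in K (A i)].
Proof.
apply/seteqP; split=> [ph Kph|_ [i _ [th Kth <-]]]; last exact/K_at.
have [i [th e]] := K_conc _ Kph; exists i => //; exists th => //.
by apply/K_at; rewrite -e.
Qed.

Lemma eq_class_prod : K P = L P <-> forall i, K (A i) = L (A i).
Proof.
split=> [KL i|KL].
  by apply/seteqP; split=> th /=; rewrite -K_at -L_at KL.
apply/seteqP; split=> ph Hph.
  have [i [th e]] := K_conc _ Hph; move: Hph.
  by rewrite e K_at L_at KL.
have [i [th e]] := L_conc _ Hph; move: Hph.
by rewrite e K_at L_at KL.
Qed.

End Classes.

(** * Maximal and prime congruences when all congruences are products *)

Hypothesis Con_prod :
  Con P = [set prod_rel A th | th in [set th | forall i, Con (A i) (th i)]].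

Lemma Con_prodP (ph : set (P * P)) : Con P ph ->
  exists2 th, forall i, Con (A i) (th i) & ph = prod_rel A th.
Proof. by rewrite Con_prod => -[th Cth <-]; exists th. Qed.

Lemma Max_concentrated (ph : set (P * P)) :
  Max P ph -> exists i th, ph = prod_rel_at A i th.
Proof.
move=> [[/Con_prodP[th Cth ->] thN] mx].
have [i iN] := prod_rel_neq_nabla _ thN.
exists i, (th i); apply/esym/mx; last exact: prod_rel_sub_at.
by split; [exact/Con_prod_rel_at|move/prod_rel_at_eq_nabla].
Qed.

Lemma Con2_concentrated (ph : set (P * P)) :
  Con2 P ph -> exists i th, ph = prod_rel_at A i th.
Proof. by move=> /sub_Con2_Max/Max_concentrated. Qed.

Lemma Spec_concentrated (ph : set (P * P)) :
  Spec P ph -> exists i th, ph = prod_rel_at A i th.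
Proof.
move=> [/Con_prodP[th Cth ->] thN prime].
have [i iN] := prod_rel_neq_nabla _ thN.
(* This is the product of [th] with its factor at [i] replaced by the total relation. *)
pose be : set (P * P) :=
  [set uv | forall j, j <> i -> th j (uv.1 j, uv.2 j)].
have Cbe : Con P be.
  split=> [u j _|u v uv j ji|u v w uv vw j ji|f a b ab j ji] /=.
  - by have [] := Cth j.
  - by have [_ s _ _] := Cth j; apply/s/uv.
  - by have [_ _ t _] := Cth j; exact: t (uv j ji) (vw j ji).
  - by have [_ _ _ o] := Cth j; apply: o => k; exact: ab.
have Cat : Con P (prod_rel_at A i (th i)) by exact/Con_prod_rel_at.
exists i, (th i); apply/seteqP; split; first exact: prod_rel_sub_at.
(* The first alternative is the goal itself. The second would make [th i] total, because points that
   agree off [i] are related by [be]. *)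
have [|//|be_ph] := prime _ _ Cat Cbe.
  move=> [u v] /(sub_commutator_setI _ _ Cat Cbe)[].
  rewrite prod_rel_atE => uvi uvj j.
  by have [->|] := pselect (j = i); last exact: uvj.
case: iN; apply/seteqP; split=> // -[x y] _.
have [u [v [ux vy uv]]] := prod_lift2 i x y.
rewrite -ux -vy; apply: (be_ph (u, v)) => j ji /=.
by rewrite uv//; have [] := Cth j.
Qed.

(** For the converse, a proper congruence above [prod_rel_at A i th] is a product whose factors off
    [i] are total. Its factor at [i] is then proper and contains [th], hence equals [th]. *)
Lemma Max_prod_rel_at i (th : set (A i * A i)) :
  Max P (prod_rel_at A i th) <-> Max (A i) th.
Proof.
split=> -[[C N] mx]; split.
- by split; [exact/Con_prod_rel_at|move/prod_rel_at_eq_nabla].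
- move=> ph [Cph phN] thph; apply: (@prod_rel_at_inj i); apply: mx.
    by split; [exact/Con_prod_rel_at|move/prod_rel_at_eq_nabla].
  exact/sub_prod_rel_at.
- by split; [exact/Con_prod_rel_at|move/prod_rel_at_eq_nabla].
- move=> ph [/Con_prodP[ps Cps ->] psN] thps.
  have [j jN] := prod_rel_neq_nabla _ psN.
  have ji : j = i.
    apply: contrapT => ji; apply: jN; apply/seteqP; split=> // -[x y] _.
    have [u [v [<- <- uv]]] := prod_lift2 j x y.
    apply: (thps (u, v)); rewrite prod_rel_atE /= uv; last exact/nesym.
    by have [] := C.
  subst j; apply/seteqP; split=> //.
  suff <- : ps i = th by exact: prod_rel_sub_at.
  apply: mx; first by split.
  by apply/(sub_prod_rel_at i)/(subset_trans thps)/prod_rel_sub_at.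
Qed.

Hypothesis commutator_prod :
  forall al be : forall i, set (A i * A i),
    (forall i, Con (A i) (al i)) -> (forall i, Con (A i) (be i)) ->
    commutator (prod_rel A al) (prod_rel A be) =
      prod_rel A (fun i => commutator (al i) (be i)).

(** Only an inclusion is claimed: off [i] the product formula gives the commutator of the total
    relation with itself, which may be proper. *)
Lemma commutator_prod_rel_at i (al be : set (A i * A i)) :
    Con (A i) al -> Con (A i) be ->
  commutator (prod_rel_at A i al) (prod_rel_at A i be) `<=`
    prod_rel_at A i (commutator al be).
Proof.
move=> Cal Cbe; rewrite {1 2}/prod_rel_at commutator_prod.
- by move=> [u v] /(_ i) /=; rewrite prod_rel_atE !(@dfwith_in {classic I}).
- by move=> j; case: (@dfwithP {classic I}) => // k _; exact: Con_nabla.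
- by move=> j; case: (@dfwithP {classic I}) => // k _; exact: Con_nabla.
Qed.

Lemma Spec_prod_rel_at i (th : set (A i * A i)) :
  Spec P (prod_rel_at A i th) <-> Spec (A i) th.
Proof.
split=> -[C N prime]; split.
- exact/Con_prod_rel_at.
- by move/prod_rel_at_eq_nabla.
- move=> al be Cal Cbe ab.
  have [||||] := prime (prod_rel_at A i al) (prod_rel_at A i be).
  + exact/Con_prod_rel_at.
  + exact/Con_prod_rel_at.
  + apply: (subset_trans (commutator_prod_rel_at _ _ _ Cal Cbe)).
    exact/sub_prod_rel_at.
  + by move/sub_prod_rel_at; left.
  + by move/sub_prod_rel_at; right.
- exact/Con_prod_rel_at.
- by move/prod_rel_at_eq_nabla.
- move=> _ _ /Con_prodP[al Cal ->] /Con_prodP[be Cbe ->].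
  rewrite commutator_prod// => ab.
  have [||] := prime (al i) (be i) (Cal i) (Cbe i).
  (* The inclusion [ab] is restricted to coordinate [i]: [u] and [v] agree elsewhere, and each
     factor commutator is reflexive. *)
  + move=> [x y] xy; have [u [v [ux vy uv]]] := prod_lift2 i x y.
    move: ab; rewrite prod_rel_atE -ux -vy => ab; apply: (ab (u, v)) => j /=.
    have [->|ji] := pselect (j = i); first by rewrite ux vy.
    have [[r _ _ _] _ _] := commutator_least (al j) (be j).
    by rewrite uv.
  + move=> ath; left; apply: (subset_trans (prod_rel_sub_at i al)).
    exact/sub_prod_rel_at.
  + move=> bth; right; apply: (subset_trans (prod_rel_sub_at i be)).
    exact/sub_prod_rel_at.
Qed.

End Product.

Theorem lemma5p2 (S : signature) (C : set (algebra S))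
    (hC : equational_class C)
    (I : Type) (hI : inhabited I) (A : I -> algebra S)
    (hA : forall i, C (A i))
    (hCon : Con (prod_algebra A) =
      [set prod_rel A th | th in [set th | forall i, Con (A i) (th i)]]) :
  Con2 (prod_algebra A) =
    \bigcup_(i in [set: I]) [set prod_rel_at A i th | th in Con2 (A i)]
  /\
  (Max (prod_algebra A) =
     \bigcup_(i in [set: I]) [set prod_rel_at A i th | th in Max (A i)]
   /\
   (Max (prod_algebra A) = Con2 (prod_algebra A) <->
    forall i, Max (A i) = Con2 (A i)))
  /\
  (congruence_modular C ->
   (forall al be : forall i, set (A i * A i),
      (forall i, Con (A i) (al i)) -> (forall i, Con (A i) (be i)) ->
      commutator (prod_rel A al) (prod_rel A be) =
        prod_rel A (fun i => commutator (al i) (be i))) ->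
   [/\ Spec (prod_algebra A) =
         \bigcup_(i in [set: I]) [set prod_rel_at A i th | th in Spec (A i)],
       Spec (prod_algebra A) = Con2 (prod_algebra A) <->
         (forall i, Spec (A i) = Con2 (A i)) &
       Spec (prod_algebra A) = Max (prod_algebra A) <->
         (forall i, Spec (A i) = Max (A i))]).
Proof.
have Con2_at := Con2_prod_rel_at (A := A).
have Max_at := Max_prod_rel_at hCon.
have Con2C := Con2_concentrated hCon.
have MaxC := Max_concentrated hCon.
split; first exact: (class_prod (@Con2 S)).
split; first split.
- exact: (class_prod (@Max S)).
- exact: (eq_class_prod (@Max S) (@Con2 S)).
move=> _ hcomm.
have Spec_at := Spec_prod_rel_at hCon hcomm.
have SpecC := Spec_concentrated hCon.
split.
- exact: (class_prod (@Spec S)).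
- exact: (eq_class_prod (@Spec S) (@Con2 S)).
- exact: (eq_class_prod (@Spec S) (@Max S)).
Qed.
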